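(* Let $\mathbf{k}$ be an algebraically closed field of characteristic $p>0$. Let $A$ be the $\mathbf{k}$-algebra $$A=\mathbf{k}\langle x,y,z\rangle/([x,y]-y,\ [x,z],\ [y,z]-yf(x),\ x^p-x,\ y^p,\ z^p-z),\qquad f(x)=\sum_{i=1}^{p-1}(-1)^{i-1}(p-i)^{-1}x^i.$$ Then $A$ is not isomorphic, as an algebra over $\mathbf{k}$, to the restricted universal enveloping algebra of any restricted Lie algebra over $\mathbf{k}$.
   Context: $[a,b]=ab-ba$. (The algebra $A$ is the underlying algebra of the connected Hopf algebra of type (B2), of dimension $p^3$, with $x,y$ primitive and $\Delta(z)=z\otimes1+1\otimes z+\sum_{i=1}^{p-1}\frac{(p-1)!}{i!(p-i)!}x^i\otimes x^{p-i}$.) *)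

(* Defs.v *)
From HB Require Import structures.
From mathcomp Require Import all_boot all_order all_algebra.
From mathcomp Require Import boolp.
From mathcomp Require Import monalg.

Set Implicit Arguments.
Unset Strict Implicit.
Unset Printing Implicit Defensive.

Import GRing.Theory.
Local Open Scope ring_scope.
Local Open Scope quotient_scope.

Definition ideal_gen (R : nzRingType) (S : R -> Prop) (u : R) : Prop :=
  exists t : seq (R * R * R),
    (forall w, w \in t -> S w.1.2) /\ u = \sum_(w <- t) w.1.1 * w.1.2 * w.2.

Section IdealGen.
Context (R : nzRingType) (S : R -> Prop).

Lemma ideal_gen0 : ideal_gen S 0.
Proof. by exists [::]; split => [w|] //; rewrite big_nil. Qed.

Lemma ideal_genD u v : ideal_gen S u -> ideal_gen S v -> ideal_gen S (u + v).
Proof.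
move=> [s [hs ->]] [t [ht ->]]; exists (s ++ t); split => [w|].
  by rewrite mem_cat => /orP[/hs|/ht].
by rewrite big_cat.
Qed.

Lemma ideal_genM a b u : ideal_gen S u -> ideal_gen S (a * u * b).
Proof.
move=> [s [hs ->]]; exists [seq (a * w.1.1, w.1.2, w.2 * b) | w <- s]; split.
  by move=> _ /mapP[w /hs ws ->].
rewrite big_map mulr_sumr mulr_suml; apply: eq_bigr => w _ /=.
by rewrite !mulrA.
Qed.

Lemma ideal_genMl a u : ideal_gen S u -> ideal_gen S (a * u).
Proof. by move/(@ideal_genM a 1); rewrite mulr1. Qed.

Lemma ideal_genMr b u : ideal_gen S u -> ideal_gen S (u * b).
Proof. by move/(@ideal_genM 1 b); rewrite mul1r. Qed.

Lemma ideal_genB u v : ideal_gen S u -> ideal_gen S v -> ideal_gen S (u - v).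
Proof.
by move=> hu hv; apply: ideal_genD => //; rewrite -mulN1r; apply: ideal_genMl.
Qed.

Lemma mem_ideal_gen u : S u -> ideal_gen S u.
Proof.
move=> Su; exists [:: (1, u, 1)]; split => [w|].
  by rewrite inE => /eqP ->.
by rewrite big_seq1 /= mul1r mulr1.
Qed.

Definition ideal_pred : R -> bool := fun u => `[< ideal_gen S u >].

Lemma ideal_predP u : reflect (ideal_gen S u) (u \in ideal_pred).
Proof. exact: asboolP. Qed.

Lemma ideal_pred_zmod_closed : zmod_closed ideal_pred.
Proof.
split=> [|u v /ideal_predP hu /ideal_predP hv]; apply/ideal_predP.
  exact: ideal_gen0.
exact: ideal_genB.
Qed.

HB.instance Definition _ :=
  GRing.isZmodClosed.Build R ideal_pred ideal_pred_zmod_closed.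
End IdealGen.

Definition ideal_zmod (R : nzRingType) (S : R -> Prop) : zmodClosed R :=
  GRing.ZmodClosed.clone R (ideal_pred S) _.

(* Properness of the ideal is an argument of the quotient because MathComp's
   algebras are nontrivial rings. *)
Definition quot_alg (R : nzRingType) (S : R -> Prop)
  of ~ ideal_gen S 1 := Quotient.quot (ideal_zmod S).

Section QuotAlg.
Context (k : comNzRingType) (R : algType k) (S : R -> Prop).
Context (S1 : ~ ideal_gen S 1).

Local Notation Q := (quot_alg S1).

HB.instance Definition _ := EqQuotient.on Q.
HB.instance Definition _ := GRing.Zmodule.on Q.

Definition quot_pi : R -> Q := \pi_Q.

Lemma quot_pi_surj (u : Q) : exists a, u = quot_pi a.
Proof. by exists (repr u); rewrite /quot_pi reprK. Qed.

Lemma quot_pi_eq a b : quot_pi a = quot_pi b <-> ideal_gen S (a - b).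
Proof.
have E : (a - b \in ideal_zmod S) = (quot_pi a == quot_pi b).
  exact: Quotient.idealrBE.
by split=> [/eqP|/ideal_predP h]; [rewrite -E => /ideal_predP | apply/eqP; rewrite -E].
Qed.

Lemma quot_pi_is_zmod_morphism : zmod_morphism quot_pi.
Proof.
exact: (@pi_is_zmod_morphism _ _ _ (Quotient.quot (ideal_zmod S))).
Qed.

HB.instance Definition _ :=
  GRing.isZmodMorphism.Build R Q quot_pi quot_pi_is_zmod_morphism.

Lemma quot_pi_repr (a : R) : ideal_gen S (repr (quot_pi a) - a).
Proof. by apply/quot_pi_eq; rewrite /quot_pi reprK. Qed.

Definition quot_one : Q := quot_pi 1.
Definition quot_mul (u v : Q) : Q := quot_pi (repr u * repr v).
Definition quot_scale (c : k) (u : Q) : Q := quot_pi (c *: repr u).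

Lemma quot_piM a b : quot_pi (a * b) = quot_mul (quot_pi a) (quot_pi b).
Proof.
apply/esym/quot_pi_eq.
rewrite -[_ - _](subrKA (a * repr (quot_pi b))) -mulrBl -mulrBr.
by apply: ideal_genD; [apply: ideal_genMr|apply: ideal_genMl];
  exact: quot_pi_repr.
Qed.

Lemma quot_piZ c a : quot_pi (c *: a) = quot_scale c (quot_pi a).
Proof.
apply/esym/quot_pi_eq; rewrite -scalerBr -[X in _ *: X]mul1r scalerAl.
exact/ideal_genMl/quot_pi_repr.
Qed.

Fact quot_mulA : associative quot_mul.
Proof.
move=> u v w; have [a ->] := quot_pi_surj u; have [b ->] := quot_pi_surj v.
by have [c ->] := quot_pi_surj w; rewrite -!quot_piM mulrA.
Qed.

Fact quot_mul1 : left_id quot_one quot_mul.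
Proof. by move=> u; have [a ->] := quot_pi_surj u; rewrite -quot_piM mul1r. Qed.

Fact quot_mulr1 : right_id quot_one quot_mul.
Proof. by move=> u; have [a ->] := quot_pi_surj u; rewrite -quot_piM mulr1. Qed.

Fact quot_mulDl : left_distributive quot_mul +%R.
Proof.
move=> u v w; have [a ->] := quot_pi_surj u; have [b ->] := quot_pi_surj v.
have [c ->] := quot_pi_surj w.
by rewrite -raddfD -!quot_piM mulrDl raddfD.
Qed.

Fact quot_mulDr : right_distributive quot_mul +%R.
Proof.
move=> u v w; have [a ->] := quot_pi_surj u; have [b ->] := quot_pi_surj v.
have [c ->] := quot_pi_surj w.
by rewrite -raddfD -!quot_piM mulrDr raddfD.
Qed.

Fact quot_oner_neq0 : quot_one != 0.
Proof. by apply/eqP; rewrite -(raddf0 quot_pi) => /quot_pi_eq; rewrite subr0. Qed.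

HB.instance Definition _ := GRing.Zmodule_isNzRing.Build Q
  quot_mulA quot_mul1 quot_mulr1 quot_mulDl quot_mulDr quot_oner_neq0.

Fact quot_scaleA a b u : quot_scale a (quot_scale b u) = quot_scale (a * b) u.
Proof. by have [c ->] := quot_pi_surj u; rewrite -!quot_piZ scalerA. Qed.

Fact quot_scale1 : left_id 1 quot_scale.
Proof. by move=> u; have [c ->] := quot_pi_surj u; rewrite -quot_piZ scale1r. Qed.

Fact quot_scaleDr : right_distributive quot_scale +%R.
Proof.
move=> c u v; have [a ->] := quot_pi_surj u; have [b ->] := quot_pi_surj v.
by rewrite -raddfD -!quot_piZ scalerDr raddfD.
Qed.

Fact quot_scaleDl u : {morph quot_scale^~ u : a b / a + b}.
Proof.
by move=> a b; have [c ->] := quot_pi_surj u; rewrite -!quot_piZ scalerDl raddfD.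
Qed.

HB.instance Definition _ := GRing.Zmodule_isLmodule.Build k Q
  quot_scaleA quot_scale1 quot_scaleDr quot_scaleDl.

Fact quot_scaleAl c (u v : Q) : c *: (u * v) = (c *: u) * v.
Proof.
have [a ->] := quot_pi_surj u; have [b ->] := quot_pi_surj v.
rewrite -[quot_pi a * _]quot_piM -[LHS]quot_piZ scalerAl quot_piM.
by rewrite quot_piZ.
Qed.

HB.instance Definition _ := GRing.Lmodule_isLalgebra.Build k Q quot_scaleAl.

Fact quot_scaleAr c (u v : Q) : c *: (u * v) = u * (c *: v).
Proof.
have [a ->] := quot_pi_surj u; have [b ->] := quot_pi_surj v.
rewrite -[quot_pi a * _]quot_piM -[LHS]quot_piZ scalerAr quot_piM.
by rewrite quot_piZ.
Qed.

HB.instance Definition _ := GRing.Lalgebra_isAlgebra.Build k Q quot_scaleAr.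

Lemma quot_pi_is_monoid_morphism : monoid_morphism quot_pi.
Proof. by split=> // a b; rewrite quot_piM. Qed.

HB.instance Definition _ :=
  GRing.isMonoidMorphism.Build R Q quot_pi quot_pi_is_monoid_morphism.

Lemma quot_pi_is_scalable : scalable quot_pi.
Proof. by move=> c a; rewrite quot_piZ. Qed.

HB.instance Definition _ :=
  GRing.isScalable.Build k R Q *:%R quot_pi quot_pi_is_scalable.
End QuotAlg.

Section FreeAlgebra.
Context (k : comNzRingType) (X : choiceType).

Fact malg_scaleAr (c : k) (u v : {malg k[{fmonom X}]}) :
  c *: (u * v) = u * (c *: v).
Proof.
have cC : c%:MP * u = u * c%:MP.
  rewrite [u]monalgE mulr_suml mulr_sumr; apply: eq_bigr => m _.
  by rewrite !malgM_def !fgmulUU mul1m mulm1 mulrC.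
rewrite -(mul_malgC c (u * v)) -(mul_malgC c v) mulrA cC; exact: esym (mulrA _ _ _).
Qed.

(* k<X>: finitely supported functions from words on X to k. *)
Definition free_alg := {malg k[{fmonom X}]}.

HB.instance Definition _ := GRing.Lalgebra.on free_alg.

HB.instance Definition _ :=
  GRing.Lalgebra_isAlgebra.Build k free_alg malg_scaleAr.

Definition gen (i : X) : free_alg := << fmu i >>.

Definition constant_term (u : free_alg) : k := u@_mone.

Fact constant_term_is_zmod_morphism : zmod_morphism constant_term.
Proof. by move=> u v; rewrite /constant_term mcoeffB. Qed.

Fact constant_term_is_monoid_morphism : monoid_morphism constant_term.
Proof.
split=> [|u v]; first exact: (rmorph1 (mcoeff (mone : {fmonom X}))).
exact: (rmorphM (mcoeff (mone : {fmonom X}))).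
Qed.

Fact constant_term_is_scalable : scalable_for *%R constant_term.
Proof. by move=> c u; rewrite /constant_term mcoeffZ. Qed.

HB.instance Definition _ := GRing.isZmodMorphism.Build free_alg k
  constant_term constant_term_is_zmod_morphism.
HB.instance Definition _ := GRing.isMonoidMorphism.Build free_alg k
  constant_term constant_term_is_monoid_morphism.
HB.instance Definition _ := GRing.isScalable.Build k free_alg k *%R
  constant_term constant_term_is_scalable.

Lemma constant_termB0 u v : constant_term u = 0 -> constant_term v = 0 ->
  constant_term (u - v) = 0.
Proof. by move=> u0 v0; rewrite rmorphB /= u0 v0 subr0. Qed.

Lemma constant_termZ0 c u : constant_term u = 0 -> constant_term (c *: u) = 0.
Proof. by move=> u0; rewrite linearZ /= u0 mulr0. Qed.

Lemma constant_termM0 u v : constant_term u = 0 -> constant_term (u * v) = 0.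
Proof. by move=> u0; rewrite rmorphM /= u0 mul0r. Qed.

Lemma constant_termX0 u n : (0 < n)%N -> constant_term u = 0 ->
  constant_term (u ^+ n) = 0.
Proof. by case: n => // n _; rewrite exprS; exact: constant_termM0. Qed.

Lemma constant_term_gen i : constant_term (gen i) = 0.
Proof. by rewrite /constant_term mcoeffU fmP fmU fm1. Qed.
End FreeAlgebra.

(* The algebra k<X | S>.  The relators are required to have zero constant term,
   so that the ideal they generate is proper. *)
Section Presentation.
Context (k : comNzRingType) (X : choiceType) (S : free_alg k X -> Prop).
Context (S_aug : forall r, S r -> constant_term r = 0).

Lemma presentation_proper : ~ ideal_gen S 1.
Proof.
move=> [t [tS]] /(congr1 (@constant_term k X)) /eqP.
rewrite rmorph1 raddf_sum big_seq big1 ?oner_eq0 // => w /tS wS /=.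
by rewrite !rmorphM /= (S_aug wS) mulr0 mul0r.
Qed.

Definition presented_alg := quot_alg presentation_proper.
HB.instance Definition _ := GRing.Algebra.on presented_alg.
End Presentation.

HB.mixin Record Lmodule_isLie (k : comNzRingType) L of GRing.Lmodule k L := {
  lie_bracket : L -> L -> L;
  lie_linearl : forall b c a a',
    lie_bracket (c *: a + a') b = c *: lie_bracket a b + lie_bracket a' b;
  lie_linearr : forall a c b b',
    lie_bracket a (c *: b + b') = c *: lie_bracket a b + lie_bracket a b';
  lie_alternating : forall a, lie_bracket a a = 0;
  lie_jacobi : forall a b c,
    lie_bracket a (lie_bracket b c) + lie_bracket b (lie_bracket c a)
      + lie_bracket c (lie_bracket a b) = 0
}.

#[short(type="lieAlgType")]
HB.structure Definition LieAlg (k : comNzRingType) :=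
  {L of GRing.Lmodule k L & Lmodule_isLie k L}.

(* Jacobson's polynomials: i * s_i(a, b) is the coefficient of t^(i-1) in
   (ad (t a + b))^(p-1) (a), computed in L[t], where u : nat -> L stands for
   the polynomial \sum_j (u j) t^j. *)
Definition ad_pencil (k : comNzRingType) (L : lieAlgType k) (a b : L)
    (u : nat -> L) (j : nat) : L :=
  lie_bracket b (u j) + (if j is j'.+1 then lie_bracket a (u j') else 0).

Definition jacobson_s (k : fieldType) (L : lieAlgType k) (p i : nat)
    (a b : L) : L :=
  i%:R^-1 *:
    iter p.-1 (ad_pencil a b) (fun j => if j == 0%N then a else 0) i.-1.

HB.mixin Record Lie_isRestricted (k : fieldType) (p : nat) L of LieAlg k L := {
  p_map : L -> L;
  p_mapZ : forall (c : k) a, p_map (c *: a) = c ^+ p *: p_map a;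
  p_map_ad : forall a b : L,
    lie_bracket (p_map a) b = iter p (lie_bracket a) b;
  p_mapD : forall a b : L,
    p_map (a + b) = p_map a + p_map b + \sum_(1 <= i < p) jacobson_s p i a b
}.

#[short(type="restrictedLieAlgType")]
HB.structure Definition RestrictedLieAlg (k : fieldType) (p : nat) :=
  {L of LieAlg k L & Lie_isRestricted k p L}.

(* T(L) is presented as the free algebra on the underlying set of L modulo the
   linearity of gen : L -> T(L). *)
Inductive u_relator (k : fieldType) (p : nat) (L : restrictedLieAlgType k p) :
    free_alg k L -> Prop :=
| u_rel_add (a b : L) : u_relator (gen k (a + b) - gen k a - gen k b)
| u_rel_scale (c : k) (a : L) : u_relator (gen k (c *: a) - c *: gen k a)
| u_rel_bracket (a b : L) : u_relator
    (gen k a * gen k b - gen k b * gen k a - gen k (lie_bracket a b))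
| u_rel_p_map (a : L) : u_relator (gen k a ^+ p - gen k (p_map a)).

Lemma u_relator_aug (k : fieldType) (p : nat) (pk : p \in [pchar k])
    (L : restrictedLieAlgType k p) r :
  @u_relator k p L r -> constant_term r = 0.
Proof.
have p0 : (0 < p)%N by case/andP: pk => /prime_gt0.
have g0 := @constant_term_gen k L; case=> [a b|c a|a b|a].
- exact: constant_termB0 (constant_termB0 (g0 _) (g0 _)) (g0 _).
- exact: constant_termB0 (g0 _) (constant_termZ0 _ (g0 _)).
- exact: constant_termB0
    (constant_termB0 (constant_termM0 _ (g0 _)) (constant_termM0 _ (g0 _)))
    (g0 _).
- exact: constant_termB0 (constant_termX0 p0 (g0 _)) (g0 _).
Qed.

Definition restricted_env (k : fieldType) (p : nat) (pk : p \in [pchar k])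
    (L : restrictedLieAlgType k p) : algType k :=
  presented_alg (@u_relator_aug k p pk L).

Definition f_poly (k : fieldType) (p : nat) (R : algType k) (x : R) : R :=
  \sum_(1 <= i < p) ((-1) ^+ i.-1 * (p - i)%:R^-1) *: x ^+ i.

Section AlgebraA.
Context (k : fieldType) (p : nat).

Let x : free_alg k 'I_3 := gen k (@Ordinal 3 0 isT).
Let y : free_alg k 'I_3 := gen k (@Ordinal 3 1 isT).
Let z : free_alg k 'I_3 := gen k (@Ordinal 3 2 isT).

Inductive A_relator : free_alg k 'I_3 -> Prop :=
| A_rel_xy : A_relator ((x * y - y * x) - y)
| A_rel_xz : A_relator (x * z - z * x)
| A_rel_yz : A_relator ((y * z - z * y) - y * f_poly p x)
| A_rel_xp : A_relator (x ^+ p - x)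
| A_rel_yp : A_relator (y ^+ p)
| A_rel_zp : A_relator (z ^+ p - z).

Lemma A_relator_aug (pk : p \in [pchar k]) r : A_relator r -> constant_term r = 0.
Proof.
have p0 : (0 < p)%N by case/andP: pk => /prime_gt0.
have [x0 y0 z0] : [/\ constant_term x = 0, constant_term y = 0
    & constant_term z = 0] by split; exact: constant_term_gen.
case.
- exact: constant_termB0
    (constant_termB0 (constant_termM0 _ x0) (constant_termM0 _ y0)) y0.
- exact: constant_termB0 (constant_termM0 _ x0) (constant_termM0 _ z0).
- exact: constant_termB0
    (constant_termB0 (constant_termM0 _ y0) (constant_termM0 _ z0))
    (constant_termM0 _ y0).
- exact: constant_termB0 (constant_termX0 p0 x0) x0.
- exact: constant_termX0 p0 y0.
- exact: constant_termB0 (constant_termX0 p0 z0) z0.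
Qed.

Definition A_alg (pk : p \in [pchar k]) : algType k :=
  presented_alg (A_relator_aug pk).
End AlgebraA.

(* Main.v *)
(* A is a truncated skew polynomial algebra: y shifts the p^2 characters of
   A / (y) = k[x, z] / (x^p - x, z^p - z) by sigma(a, b) = (a + 1, b - f(a)), and
   sigma^p moves b by -sum_j f(a + j) = +-1, so sigma^p has no fixed point.  The
   two-dimensional triangular representations of A with noncommutative image
   are exactly those with diagonal (sigma(mu), mu) and y <> 0.  If A were u(L),
   start from such a representation with mu the counit of u(L), let c be its
   upper diagonal character, and compose it repeatedly with the winding
   endomorphism l |-> l + c(l) of u(L): the lower diagonal characters are
   0, c, 2c, ... on L and successive ones differ by sigma, so that
   sigma^p(counit) = p c = counit, a contradiction. *)
From HB Require Import structures.
Require Import Defs.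
From mathcomp Require Import all_boot all_order all_algebra.
From mathcomp Require Import boolp monalg.
Import GRing.Theory.
Local Open Scope ring_scope.
Set Implicit Arguments.
Unset Strict Implicit.
Unset Printing Implicit Defensive.

(** * The universal property of the free algebra *)

Section FreeAlgebraMaps.
Context (k : comNzRingType) (X : choiceType).

(** Elements are linear combinations of words, and a word is a product of generators, by induction
    on its length. *)
Lemma free_alg_ind (P : free_alg k X -> Prop) :
  P 1 -> (forall i, P (gen k i)) -> (forall u v, P u -> P v -> P (u + v)) ->
  (forall c u, P u -> P (c *: u)) -> (forall u v, P u -> P v -> P (u * v)) ->
  forall u, P u.
Proof.
move=> P1 Pg PD PZ PM u.
have P0 : P 0 by rewrite -(scale0r 1); apply: PZ.
have Pm (s : seq X) : P << FMonom s >>.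
  elim: s => [|i s IHs]; first by rewrite -fmoneE.
  have -> : << FMonom (i :: s) >> = gen k i * << FMonom s >> :> free_alg k X.
    rewrite /gen [RHS]malgM_def fgmulUU mulr1; congr << _ >>.
    by apply/eqP; rewrite fmP fmM fmU.
  exact: PM.
rewrite [u]monalgE; apply: (big_ind P) => // -[s] _.
have -> : << u@_(FMonom s) *g FMonom s >> = u@_(FMonom s) *: << FMonom s >>
    :> free_alg k X.
  by apply/malgP => m; rewrite mcoeffZ !mcoeffU mulr_natr.
exact/PZ/Pm.
Qed.

Context (B : algType k) (h : X -> B).

Definition word_eval (m : {fmonom X}) : B := \prod_(i <- m) h i.

Fact word_eval_mmorphism : mmorphism word_eval.
Proof. by split=> [m n|]; rewrite /word_eval ?fm1 ?big_nil // fmM big_cat. Qed.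

HB.instance Definition _ :=
  isMultiplicative.Build {fmonom X} B word_eval word_eval_mmorphism.

Definition free_lift (u : free_alg k X) : B := mmap (in_alg B) word_eval u.

Fact free_lift_is_zmod_morphism : zmod_morphism free_lift.
Proof. by move=> u v; rewrite /free_lift mmapB. Qed.

Fact free_lift_is_monoid_morphism : monoid_morphism free_lift.
Proof.
have [|fM f1] := @commr_mmap_is_multiplicative _ _ _ (in_alg B) word_eval.
  by move=> u m m'; rewrite /GRing.comm /= mulr_algl mulr_algr.
by split; [exact: f1|exact: fM].
Qed.

Fact free_lift_is_scalable : scalable free_lift.
Proof. by move=> c u; rewrite /free_lift mmapZ /= mulr_algl. Qed.

HB.instance Definition _ :=
  GRing.isZmodMorphism.Build (free_alg k X) B free_lift free_lift_is_zmod_morphism.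
HB.instance Definition _ :=
  GRing.isMonoidMorphism.Build (free_alg k X) B free_lift
    free_lift_is_monoid_morphism.
HB.instance Definition _ :=
  GRing.isScalable.Build k (free_alg k X) B *:%R free_lift free_lift_is_scalable.

Lemma free_lift_gen i : free_lift (gen k i) = h i.
Proof. by rewrite /free_lift mmapU /= scale1r mul1r /word_eval fmU big_seq1. Qed.
End FreeAlgebraMaps.

(** * Generating families of an algebra *)

Section Generation.
Context (k : comNzRingType) (Q : algType k) (I : Type) (g : I -> Q).

(** Generation is phrased as an induction principle, so that no subalgebra or span of words has to
    be formed. *)
Definition generates : Prop := forall P : Q -> Prop,
  P 1 -> (forall i, P (g i)) -> (forall u v, P u -> P v -> P (u + v)) ->
  (forall c u, P u -> P (c *: u)) -> (forall u v, P u -> P v -> P (u * v)) ->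
  forall u, P u.

Context (g_gen : generates) (B : algType k).

(** A commutant is a subalgebra. This is used twice: first to pass from generators to all elements
    on one side, then on the other. *)
Lemma generates_comm (r : {lrmorphism Q -> B}) :
  (forall i j, GRing.comm (r (g i)) (r (g j))) ->
  forall u v, GRing.comm (r u) (r v).
Proof.
move=> rC.
have step b : (forall i, GRing.comm b (r (g i))) -> forall v, GRing.comm b (r v).
  move=> bC; apply: g_gen => [|i|u v bu bv|c u bu|u v bu bv].
  - by rewrite rmorph1; exact: commr1.
  - exact: bC.
  - by rewrite rmorphD; exact: commrD.
  - by rewrite linearZ /GRing.comm /= -scalerAl -scalerAr bu.
  - by rewrite rmorphM; exact: commrM.
move=> u; apply: (step) => i; exact/commr_sym/step.
Qed.

Lemma generates_ext (r s : {lrmorphism Q -> B}) :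
  (forall i, r (g i) = s (g i)) -> r =1 s.
Proof.
move=> rs; apply: g_gen => [|//|u v ru rv|c u ru|u v ru rv].
- by rewrite !rmorph1.
- by rewrite !rmorphD; congr (_ + _).
- by rewrite !linearZ /=; congr (_ *: _).
- by rewrite !rmorphM; congr (_ * _).
Qed.
End Generation.

(** * The universal property of a presented algebra *)

Section PresentedAlgebraMaps.
Context (k : comNzRingType) (X : choiceType) (S : free_alg k X -> Prop).
Context (S_aug : forall r, S r -> constant_term r = 0).

Local Notation Q := (presented_alg S_aug).

Definition proj : {lrmorphism free_alg k X -> Q} :=
  GRing.LRMorphism.clone k (free_alg k X) Q *:%R
    (@quot_pi k (free_alg k X) S (presentation_proper S_aug)) _.

Lemma proj_surj u : exists a, u = proj a.
Proof. exact: (@quot_pi_surj k (free_alg k X) S (presentation_proper S_aug)). Qed.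

Definition pgen (i : X) : Q := proj (gen k i).

Lemma proj_relator r : S r -> proj r = 0.
Proof.
move=> Sr; rewrite -(raddf0 proj); apply/quot_pi_eq.
by rewrite subr0; exact: mem_ideal_gen.
Qed.

Lemma presented_generates : generates pgen.
Proof.
move=> P P1 Pg PD PZ PM u; have [a ->] := proj_surj u.
apply: (free_alg_ind (P := fun a => P (proj a))) a => [|||c a|a b].
- by rewrite rmorph1.
- exact: Pg.
- by move=> a b; rewrite rmorphD; apply: PD.
- by rewrite linearZ; apply: PZ.
- by rewrite rmorphM; apply: PM.
Qed.

Lemma presented_lift (B : algType k) (h : X -> B) :
  (forall r, S r -> free_lift h r = 0) ->
  exists F : {lrmorphism Q -> B}, forall i, F (pgen i) = h i.
Proof.
move=> hS.
(* The lift is evaluated on a chosen representative; the choice is harmless because two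
   representatives differ by an element of the ideal, which [free_lift h] kills. *)
pose F (u : Q) : B := free_lift h (repr u).
have FE a : F (proj a) = free_lift h a.
  have [t [tS e]] := quot_pi_repr (presentation_proper S_aug) a.
  apply/eqP; rewrite -subr_eq0 -raddfB /=.
  rewrite [X in free_lift h X]e raddf_sum big_seq big1 //= => w /tS wS.
  by rewrite !rmorphM /= (hS _ wS) mulr0 mul0r.
have F_zmod : zmod_morphism F.
  move=> u v; have [a ->] := proj_surj u; have [b ->] := proj_surj v.
  by rewrite -raddfB !FE raddfB.
have F_monoid : monoid_morphism F.
  split=> [|u v]; first by rewrite -(rmorph1 proj) FE rmorph1.
  have [a ->] := proj_surj u; have [b ->] := proj_surj v.
  by rewrite -rmorphM !FE rmorphM.
have F_scal : scalable F.
  move=> c u; have [a ->] := proj_surj u.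
  by rewrite -linearZ !FE linearZ.
pose Fz := GRing.isZmodMorphism.Build Q B F F_zmod.
pose Fm := GRing.isMonoidMorphism.Build Q B F F_monoid.
pose Fs := GRing.isScalable.Build k Q B *:%R F F_scal.
pose FF : {lrmorphism Q -> B} := HB.pack F Fz Fm Fs.
by exists FF => i; rewrite [LHS]FE free_lift_gen.
Qed.
End PresentedAlgebraMaps.

(** * Power sums over the prime field and the values of f *)

Section PowerSums.
Context (k : fieldType) (p : nat) (pk : p \in [pchar k]).

Let p_prime : prime p. Proof. by case/andP: pk. Qed.

(** Summing [(j + 1)^(i + 1) - j^(i + 1)] telescopes to [p^(i + 1) = 0]. In the binomial expansion
    the power sums below i vanish by induction, which leaves [i + 1] times the i-th one, and [i + 1]
    is invertible in k. *)
Lemma power_sum_eq0 i : (i.+1 < p)%N -> \sum_(j < p) (j%:R : k) ^+ i = 0.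
Proof.
elim/ltn_ind: i => i IHi ip.
have /eqP : \sum_(j < p) ((j.+1%:R : k) ^+ i.+1 - j%:R ^+ i.+1) = 0.
  rewrite -(big_mkord xpredT (fun j => j.+1%:R ^+ i.+1 - j%:R ^+ i.+1)).
  rewrite (telescope_sumr (fun j => (j%:R : k) ^+ i.+1)) //= pcharf0 //.
  by rewrite subrr.
have -> : \sum_(j < p) ((j.+1%:R : k) ^+ i.+1 - j%:R ^+ i.+1) =
    \sum_(l < i.+1) (\sum_(j < p) (j%:R : k) ^+ l) *+ 'C(i.+1, l).
  rewrite (eq_bigr (fun j : 'I_p => \sum_(l < i.+1) (j%:R : k) ^+ l *+ 'C(i.+1, l))).
    by rewrite exchange_big /=; apply: eq_bigr => l _; rewrite sumrMnl.
  move=> j _; rewrite -nat1r exprDn big_ord_recr /= subnn expr0 mul1r.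
  rewrite binn mulr1n addrK; apply: eq_bigr => l _.
  by rewrite expr1n mul1r.
rewrite big_ord_recr /= big1 ?add0r => [|l _]; last first.
  by rewrite IHi ?mul0rn // (leq_ltn_trans (ltn_ord l)) // ltnW.
rewrite binSn -mulr_natr mulf_eq0 -(dvdn_pcharf pk) gtnNdvd // orbF.
by move/eqP.
Qed.

(** By Fermat each of the [p - 1] nonzero residues contributes 1, and 0 contributes 0. *)
Lemma power_sum_predp : \sum_(j < p) (j%:R : k) ^+ p.-1 = -1.
Proof.
have p_gt0 := prime_gt0 p_prime.
have [q pE] : exists q, p = q.+1 by exists p.-1; rewrite prednK.
rewrite (eq_bigr (fun j : 'I_p => ((j : nat) != 0%N)%:R)) => [|j _].
  rewrite pE big_ord_recl /= add0r sumr_const card_ord.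
  by apply/eqP; rewrite -subr_eq0 opprK natr1 -pE pcharf0.
have [->|j0] := eqVneq (j : nat) 0%N.
  by rewrite expr0n eqn0Ngt -ltnS prednK // prime_gt1.
have jR : (j%:R : k) != 0 by rewrite -(dvdn_pcharf pk) gtnNdvd // lt0n.
apply: (mulfI jR); rewrite -exprS prednK // mulr1.
by rewrite -(pFrobenius_autE pk) pFrobenius_aut_nat.
Qed.

(** In the binomial expansion every term except [j^i] carries a power sum of exponent below [p - 1],
    which is zero. *)
Lemma power_sum_shift (a : k) i : (i < p)%N ->
  \sum_(j < p) (a + j%:R) ^+ i = \sum_(j < p) (j%:R : k) ^+ i.
Proof.
move=> ip; under eq_bigr do rewrite exprDn.
rewrite exchange_big big_ord_recr /= big1 ?add0r => [|l _].
  by apply: eq_bigr => j _; rewrite subnn mul1r binn.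
rewrite sumrMnl -mulr_sumr power_sum_eq0 ?mulr0 ?mul0rn //.
exact: leq_ltn_trans ip.
Qed.

(** Only the term of degree [p - 1] survives the summation over j. Its coefficient in f is a sign,
    since [p - (p - 1) = 1], so the sum is 1 or -1. This makes the p-th power of sigma free of fixed
    points. *)
Lemma f_poly_sum_neq0 (a : k) :
  \sum_(j < p) (f_poly p (a + j%:R : k^o) : k) != 0.
Proof.
have p_gt1 := prime_gt1 p_prime; have p_gt0 := ltnW p_gt1.
have predp_gt0 : (0 < p.-1)%N by rewrite -ltnS prednK.
pose c i : k := (-1) ^+ i.-1 * (p - i)%:R^-1.
rewrite /f_poly exchange_big /= big_nat.
rewrite (eq_bigr (fun i => c i * \sum_(j < p) (j%:R : k) ^+ i)); last first.
  by move=> i /andP[_ ip]; rewrite -(power_sum_shift a ip) mulr_sumr.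
rewrite -big_nat (bigD1_seq p.-1); first last.
- exact: iota_uniq.
- by rewrite mem_index_iota predp_gt0 ltn_predL.
rewrite /= [X in _ + X]big1_seq ?addr0 => [|i /andP[ip]].
  have sub_predp : (p - p.-1 = 1)%N by rewrite -subn1 subKn.
  rewrite power_sum_predp /c sub_predp invr1 mulr1.
  by rewrite mulf_neq0 ?signr_eq0 // oppr_eq0 oner_eq0.
rewrite mem_index_iota => /andP[_ i_lt]; rewrite power_sum_eq0 ?mulr0 //.
by rewrite -[p]prednK // ltnS ltn_neqAle ip -ltnS prednK.
Qed.

(** The coefficients of f lie in the prime field, so Frobenius fixes them. Hence sigma preserves the
    equation [b^p = b]. *)
Lemma f_poly_Frobenius (a : k) : a ^+ p = a ->
  (f_poly p (a : k^o) : k) ^+ p = f_poly p (a : k^o).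
Proof.
move=> ap; rewrite -(pFrobenius_autE pk) /f_poly rmorph_sum /=.
apply: eq_bigr => i _.
rewrite [LHS](rmorphM (pFrobenius_aut pk)) /=; congr (_ * _); last first.
  by rewrite rmorphXn /= pFrobenius_autE ap.
by rewrite rmorphM rmorphXn rmorphN1 fmorphV rmorph_nat.
Qed.
End PowerSums.

(** * Triangular 2 x 2 representations and their diagonal characters *)

Section TriangularRepresentations.
Context (k : fieldType).

Lemma mulmx2E (M N : 'M[k]_2) i j :
  (M * N) i j = M i 0 * N 0 j + M i 1 * N 1 j.
Proof.
rewrite mxE big_ord_recl big_ord1; congr (_ * _ + M i _ * N _ j); exact/val_inj.
Qed.

Lemma ord2_cases (i : 'I_2) : i = 0 \/ i = 1.
Proof. by case: i => -[|[|//]] ?; [left|right]; exact/val_inj. Qed.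

Lemma eq_mx2 (M N : 'M[k]_2) : M 0 0 = N 0 0 -> M 0 1 = N 0 1 ->
  M 1 0 = N 1 0 -> M 1 1 = N 1 1 -> M = N.
Proof.
move=> e00 e01 e10 e11; apply/matrixP.
by move=> i j; have [->|->] := ord2_cases i; have [->|->] := ord2_cases j.
Qed.

(** For upper triangular matrices the diagonal entries multiply separately. The target is [k^o],
    that is, k as an algebra over itself. *)
Lemma diag_char (B : algType k) (r : {lrmorphism B -> 'M[k]_2}) (i : 'I_2) :
  (forall u, r u 1 0 = 0) ->
  exists c : {lrmorphism B -> k^o}, forall u, c u = r u i i.
Proof.
move=> r10; pose c (u : B) : k^o := r u i i.
have cz : zmod_morphism c by move=> u v; rewrite /c raddfB !mxE.
have cm : monoid_morphism c.
  split=> [|u v]; first by rewrite /c rmorph1 mxE eqxx.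
  rewrite /c rmorphM mulmx2E.
  have [->|->] := ord2_cases i; rewrite r10.
    by rewrite mulr0 addr0.
  by rewrite mul0r add0r.
have cs : scalable c by move=> a u; rewrite /c linearZ mxE.
pose Fz := GRing.isZmodMorphism.Build B k^o c cz.
pose Fm := GRing.isMonoidMorphism.Build B k^o c cm.
pose Fs := GRing.isScalable.Build k B k^o *:%R c cs.
pose FF : {lrmorphism B -> k^o} := HB.pack c Fz Fm Fs.
by exists FF.
Qed.

Definition diag2 (a b : k) : 'M[k]_2 :=
  diag_mx (\row_j if j == 0 then a else b).

Lemma diag2E a b : [/\ diag2 a b 0 0 = a, diag2 a b 0 1 = 0,
  diag2 a b 1 0 = 0 & diag2 a b 1 1 = b].
Proof. by split; rewrite !mxE. Qed.

Lemma diag2M a b c d : diag2 a b * diag2 c d = diag2 (a * c) (b * d).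
Proof.
have [e00 e01 e10 e11] := diag2E a b; have [f00 f01 f10 f11] := diag2E c d.
have [g00 g01 g10 g11] := diag2E (a * c) (b * d).
apply: eq_mx2; rewrite mulmx2E ?e00 ?e01 ?e10 ?e11 ?f00 ?f01 ?f10 ?f11;
  by rewrite ?g00 ?g01 ?g10 ?g11 ?mul0r ?mulr0 ?addr0 ?add0r.
Qed.

Lemma diag2X a b n : diag2 a b ^+ n = diag2 (a ^+ n) (b ^+ n).
Proof.
elim: n => [|n IHn]; last by rewrite !exprS IHn diag2M.
by rewrite !expr0; apply: eq_mx2; rewrite !mxE.
Qed.

Lemma f_poly_morph p (B C : algType k) (r : {lrmorphism B -> C}) u :
  r (f_poly p u) = f_poly p (r u).
Proof.
rewrite /f_poly linear_sum; apply: eq_bigr => i _.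
by rewrite linearZ /=; congr (_ *: _); exact: rmorphXn.
Qed.

Lemma f_poly_diag2 p a b :
  f_poly p (diag2 a b) = diag2 (f_poly p (a : k^o)) (f_poly p (b : k^o)).
Proof.
have [g00 g01 g10 g11] := diag2E (f_poly p (a : k^o)) (f_poly p (b : k^o)).
rewrite /f_poly; under eq_bigr do rewrite diag2X.
apply: eq_mx2; rewrite ?g00 ?g01 ?g10 ?g11 summxE.
- by apply: eq_bigr => i _; rewrite !mxE.
- by apply: big1 => i _; rewrite !mxE mulr0.
- by apply: big1 => i _; rewrite !mxE mulr0.
- by apply: eq_bigr => i _; rewrite !mxE.
Qed.
End TriangularRepresentations.

(** * Two-dimensional representations of A *)

Definition A_relations (k : fieldType) (p : nat) (B : algType k) (x y z : B) : Prop :=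
  [/\ x * y - y * x = y, x * z = z * x, y * z - z * y = y * f_poly p x,
    y ^+ p = 0 & x ^+ p = x /\ z ^+ p = z].

Section RepresentationsOfA.
Context (k : fieldType) (p : nat).

(** Translates between equations and killed relators: one direction gives the relations in A itself,
    the other lets maps descend to A. *)
Lemma A_relations_morph (R B : algType k) (r : {lrmorphism R -> B}) (x y z : R) :
  A_relations p (r x) (r y) (r z) <->
  [/\ r ((x * y - y * x) - y) = 0, r (x * z - z * x) = 0,
    r ((y * z - z * y) - y * f_poly p x) = 0, r (y ^+ p) = 0 &
    r (x ^+ p - x) = 0 /\ r (z ^+ p - z) = 0].
Proof.
have sub_eq0 (u v : B) : u - v = 0 <-> u = v.
  by split=> [/eqP|->]; rewrite ?subrr // subr_eq0 => /eqP.
rewrite /A_relations -f_poly_morph -!rmorphXn -!rmorphM -!rmorphB !raddfB.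
by split=> -[/sub_eq0 ? /sub_eq0 ? /sub_eq0 ? ? [/sub_eq0 ? /sub_eq0 ?]].
Qed.

Lemma A_relations_map (R B : algType k) (r : {lrmorphism R -> B}) (x y z : R) :
  A_relations p x y z -> A_relations p (r x) (r y) (r z).
Proof.
case=> exy exz eyz eyp [exp ezp].
by rewrite /A_relations -f_poly_morph -!rmorphXn -!rmorphM -!rmorphB
  exy exz eyz eyp exp ezp rmorph0.
Qed.

(** The upper right entries of the relations for [[x,y]] and [[y,z]] are multiples of [y 0 1];
    cancelling it leaves the formula for sigma. *)
Lemma A_relations_triangular (x y z : 'M[k]_2) : A_relations p x y z ->
  y 0 0 = 0 -> y 1 1 = 0 -> y 0 1 != 0 ->
  x 0 0 = x 1 1 + 1 /\ z 0 0 = z 1 1 - f_poly p x 1 1.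
Proof.
move=> [exy _ eyz _ _] y00 y11 y01.
have /= := congr1 (fun M : 'M_2 => M 0 1) exy.
have /= := congr1 (fun M : 'M_2 => M 0 1) eyz.
rewrite mxE [(- _ : 'M_2) _ _]mxE !mulmx2E y00 y11 !mul0r mulr0 !add0r addr0.
move=> ez; rewrite mxE [(- _ : 'M_2) _ _]mxE !mulmx2E y00 y11.
rewrite mul0r mulr0 add0r addr0 => ex.
split; apply: (mulIf y01).
  by move/eqP: ex; rewrite subr_eq => /eqP ->; rewrite mulrDl mul1r addrC mulrC.
rewrite mulrBl [z 1 1 * _]mulrC [f_poly p x 1 1 * _]mulrC -ez.
by rewrite opprB addrC subrK.
Qed.

Context (Q : algType k) (g : 'I_3 -> Q) (g_gen : generates g).

Local Notation x := (g (@Ordinal 3 0 isT)).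
Local Notation y := (g (@Ordinal 3 1 isT)).
Local Notation z := (g (@Ordinal 3 2 isT)).

Context (g_rel : A_relations p x y z).

Lemma A_gen_cases (P : Q -> Prop) : P x -> P y -> P z -> forall i, P (g i).
Proof.
by move=> Px Py Pz [[|[|[|//]]] lt_i]; rewrite (bool_irrelevance lt_i isT).
Qed.

(** The generator y is nilpotent and a field has no nonzero nilpotents. *)
Lemma A_char_y (c : {lrmorphism Q -> k^o}) : c y = 0.
Proof.
have [_ _ _ /eqP + _] := A_relations_map c g_rel.
by rewrite (@expf_eq0 k) => /andP[_ /eqP].
Qed.

Lemma A_triangular_diag (r : {lrmorphism Q -> 'M[k]_2}) :
  (forall u, r u 1 0 = 0) -> ~ (forall u v, GRing.comm (r u) (r v)) ->
  r x 0 0 = r x 1 1 + 1 /\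
  r z 0 0 = r z 1 1 - f_poly p (r x 1 1 : k^o).
Proof.
move=> r10 rnC; have rel := A_relations_map r g_rel.
have [c0 c0E] := diag_char 0 r10; have [c1 c1E] := diag_char 1 r10.
have y00 : r y 0 0 = 0 by rewrite -c0E A_char_y.
have y11 : r y 1 1 = 0 by rewrite -c1E A_char_y.
have fx11 : f_poly p (r x) 1 1 = f_poly p (r x 1 1 : k^o).
  by rewrite -c1E -!f_poly_morph c1E.
rewrite -fx11; apply: (A_relations_triangular rel y00 y11).
(* If [y 0 1] vanished, y would act by zero; since x and z commute, all generators would then
   commute. *)
apply/eqP => y01; apply: rnC; apply: (generates_comm g_gen).
have y0 : r y = 0.
  apply: eq_mx2; rewrite [RHS]mxE; [exact: y00|exact: y01|exact: r10|exact: y11].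
have yC M : GRing.comm (r y) M by rewrite y0; apply: commr_sym; exact: commr0.
have xzC : GRing.comm (r x) (r z) by case: rel.
pose C u v := GRing.comm (r u) (r v).
apply: (A_gen_cases (P := fun u => forall j, C u (g j)));
  apply: A_gen_cases; rewrite /C //; exact: commr_sym.
Qed.

End RepresentationsOfA.

(** Converse construction: the character (a, b) is placed in the lower corner, its image under sigma
    in the upper one, and y becomes the matrix unit joining them. *)
Lemma A_relations_mx (k : fieldType) (p : nat) (pk : p \in [pchar k]) (a b : k) :
  a ^+ p = a -> b ^+ p = b ->
  A_relations p (diag2 (a + 1) a) (delta_mx 0 1)
    (diag2 (b - f_poly p (a : k^o)) b).
Proof.
move=> ap bp; set c := b - _.
have p_gt1 : (1 < p)%N by rewrite prime_gt1 //; case/andP: pk.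
have a1p : (a + 1) ^+ p = a + 1.
  by rewrite -(pFrobenius_autE pk) rmorphD rmorph1 /= pFrobenius_autE ap.
have cp : c ^+ p = c.
  by rewrite -(pFrobenius_autE pk) rmorphB /= !pFrobenius_autE f_poly_Frobenius ?bp.
have dE s t : diag2 s t * delta_mx 0 1 = s *: delta_mx 0 1 :> 'M[k]_2 /\
    delta_mx 0 1 * diag2 s t = t *: delta_mx 0 1 :> 'M[k]_2.
  have [e00 e01 e10 e11] := diag2E s t.
  by split; apply: eq_mx2; rewrite mulmx2E ?e00 ?e01 ?e10 ?e11 !mxE /=;
    rewrite ?mulr1 ?mulr0 ?mul0r ?mul1r ?addr0 ?add0r.
split; [| | | |split].
- by rewrite !(dE _ _).1 !(dE _ _).2 -scalerBl addrAC subrr add0r scale1r.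
- rewrite !diag2M; congr diag2; exact: mulrC.
- by rewrite f_poly_diag2 !(dE _ _).1 !(dE _ _).2 -scalerBl /c opprB addrC subrK.
(* As p is at least 2, it suffices that the matrix unit squares to zero. *)
- case: p p_gt1 {pk ap bp c cp a1p} => [|[|n]] // _.
  rewrite !exprS mulrA [X in X * _](_ : _ = 0) ?mul0r //.
  by apply: eq_mx2; rewrite mulmx2E !mxE /= ?mulr0 ?mul0r ?addr0.
- by rewrite diag2X ap a1p.
- by rewrite diag2X bp cp.
Qed.

Lemma comm_shift (k : fieldType) (B : algType k) (u v : B) (s t : k) :
  GRing.comm (u + s *: 1) (v + t *: 1) -> GRing.comm u v.
Proof.
have scC w e : GRing.comm w (e *: 1 : B).
  by rewrite /GRing.comm -scalerAl -scalerAr mul1r mulr1.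
have step (w w' : B) e : GRing.comm (w + e *: 1) w' -> GRing.comm w w'.
  move=> C; rewrite -[w](addrK (e *: 1 : B)); apply: commr_sym.
  by apply: commrB; [exact: commr_sym|exact: scC].
by move/step/commr_sym/step/commr_sym.
Qed.

(** * Winding endomorphisms of u(L) and the orbit of the counit *)

Section RestrictedRepresentations.
Context (k : fieldType) (p : nat) (pk : p \in [pchar k]).
Context (L : restrictedLieAlgType k p).

Definition restricted_map (B : algType k) (h : L -> B) : Prop :=
  [/\ forall a b, h (a + b) = h a + h b, forall c a, h (c *: a) = c *: h a,
    forall a b, h a * h b - h b * h a = h (lie_bracket a b) &
    forall a, h a ^+ p = h (p_map a)].

(** For [B = k^o] this induces the counit of u(L). *)
Lemma restricted_map0 (B : algType k) : restricted_map (fun=> 0 : B).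
Proof.
split=> [a b|c a|a b|a]; rewrite ?addr0 ?scaler0 ?mulr0 ?subr0 //.
by rewrite expr0n -(prednK (prime_gt0 (pcharf_prime pk))).
Qed.

(** A character kills commutators, so the added scalars do not disturb brackets. They are central,
    so the p-th power of the sum is the sum of the p-th powers, and c commutes with taking p-th
    powers. *)
Lemma restricted_map_shift (B : algType k) (h : L -> B)
    (c : {lrmorphism B -> k^o}) :
  restricted_map h -> restricted_map (fun a => h a + c (h a) *: 1).
Proof.
case=> hD hZ hL hp; have cC u v : c u * c v = c v * c u := mulrC (c u : k) (c v).
split=> [a b|e a|a b|a].
- by rewrite hD rmorphD scalerDl addrACA.
- by rewrite hZ linearZ /= scalerDr scalerA.
- have sub_shift (X Y S T W : B) : X + T + (S + W) - (Y + S + (T + W)) = X - Y.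
    by rewrite -(addrA X) -(addrA Y) (addrCA S T) opprD addrACA subrr addr0.
  rewrite -hL rmorphB !rmorphM /= cC subrr scale0r addr0 !mulrDl !mulrDr.
  rewrite -!scalerAl -!scalerAr !mul1r !mulr1 !scalerA [c (h b) * _]cC.
  exact: sub_shift.
- have pB : p \in [pchar B] by rewrite pchar_lalg.
  rewrite -(pFrobenius_autE pB) pFrobenius_autD_comm.
    rewrite !pFrobenius_autE exprZn expr1n hp; congr (_ + _ *: _).
    by rewrite -hp rmorphXn.
  by rewrite /GRing.comm -scalerAl -scalerAr mul1r mulr1.
Qed.

Lemma restricted_map_comp (R B : algType k) (r : {lrmorphism R -> B}) (h : L -> R) :
  restricted_map (fun a => r (h a)) <->
  [/\ forall a b, r (h (a + b) - h a - h b) = 0,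
    forall c a, r (h (c *: a) - c *: h a) = 0,
    forall a b, r (h a * h b - h b * h a - h (lie_bracket a b)) = 0 &
    forall a, r (h a ^+ p - h (p_map a)) = 0].
Proof.
split=> -[hD hZ hL hp]; split=> [a b|c a|a b|a].
- by rewrite !rmorphB /= hD -addrA -opprD subrr.
- by rewrite rmorphB /= linearZ /= hZ subrr.
- by rewrite !rmorphB !rmorphM /= hL subrr.
- by rewrite rmorphB rmorphXn /= hp subrr.
- apply/eqP; rewrite -subr_eq0 opprD addrA; apply/eqP.
  by have := hD a b; rewrite !rmorphB.
- apply/eqP; rewrite -subr_eq0; apply/eqP.
  by have := hZ c a; rewrite rmorphB /= linearZ.
- apply/eqP; rewrite -subr_eq0; apply/eqP.
  by have := hL a b; rewrite !rmorphB !rmorphM.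
- apply/eqP; rewrite -subr_eq0; apply/eqP.
  by have := hp a; rewrite rmorphB rmorphXn.
Qed.

Context (U : algType k) (i : L -> U).

Context (i_gen : generates i) (i_rel : restricted_map i).
Context (i_lift : forall (B : algType k) (h : L -> B), restricted_map h ->
  exists F : {lrmorphism U -> B}, forall a, F (i a) = h a).
Context (A : algType k) (g : 'I_3 -> A) (g_gen : generates g).

Local Notation x := (g (@Ordinal 3 0 isT)).
Local Notation y := (g (@Ordinal 3 1 isT)).
Local Notation z := (g (@Ordinal 3 2 isT)).

Context (g_rel : A_relations p x y z).
Context (g_lift : forall X Y Z : 'M[k]_2, A_relations p X Y Z ->
  exists r : {lrmorphism A -> 'M[k]_2}, [/\ r x = X, r y = Y & r z = Z]).
Context (f : {lrmorphism A -> U}) (f' : {lrmorphism U -> A}).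
Context (f'K : cancel f' f) (fK : cancel f f').

Local Notation F t := (f_poly p (t : k^o)).

Lemma first_representation : exists2 r : {lrmorphism U -> 'M[k]_2},
  (forall u, r u 1 0 = 0) /\ (forall a, r (i a) 1 1 = 0) &
  ~ (forall a b, GRing.comm (r (i a)) (r (i b))).
Proof.
have [e eE] := i_lift (restricted_map0 k^o).
(* The lower character is the counit [e] transported to A; its values at x and z are fixed by
   Frobenius, as the matrix construction requires. *)
have [_ _ _ _ [xp zp]] := A_relations_map (e \o f) g_rel.
have [r [rx ry rz]] := g_lift (A_relations_mx pk xp zp).
have r10 u : r u 1 0 = 0.
  move: u; apply: g_gen => [|j|u v ru rv|c u ru|u v ru rv].
  - by rewrite rmorph1 mxE.
  - by apply: (A_gen_cases (P := fun u => r u 1 0 = 0)) j;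
      rewrite ?rx ?ry ?rz !mxE.
  - by rewrite rmorphD mxE ru rv addr0.
  - by rewrite linearZ mxE ru mulr0.
  - by rewrite rmorphM mulmx2E ru rv mulr0 mul0r addr0.
have [c cE] := diag_char 1 r10.
(* Characters of A are determined on generators; at y both sides vanish. *)
have ce : c =1 e \o f.
  apply: (generates_ext g_gen) => j.
  apply: (A_gen_cases (P := fun u => c u = (e \o f) u)) j.
  - by rewrite cE rx !mxE.
  - by rewrite !(A_char_y g_rel).
  - by rewrite cE rz !mxE.
exists (r \o f'); first split => [u|a] /=; first exact: r10.
  by rewrite -cE ce /= f'K eE.
(* With a commutative image, [[x,y] = y] would force the matrix unit [r y] to be zero. *)
move/(generates_comm i_gen) => C.
have [+ _ _ _ _] := A_relations_map r g_rel.
have /= := C (f x) (f y); rewrite !fK => ->; rewrite subrr ry.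
move/(congr1 (fun M : 'M_2 => M 0 1)); rewrite !mxE /= => /eqP.
by rewrite eq_sym oner_eq0.
Qed.

Lemma not_restricted_env : False.
Proof.
have [r0 [r0_tri r0_low] r0_nC] := first_representation.
have [c cE] := diag_char 0 r0_tri.
(* The winding endomorphism of U attached to the upper character [c] of the first representation. *)
have [t tE] := i_lift (restricted_map_shift c i_rel).
pose a := r0 (f x) 1 1; pose b := r0 (f z) 1 1.
(* After n windings the diagonal characters are [(n + 1) c] and [n c] on L, while the lower one
   takes on x and z the values of the n-th iterate of sigma at (a, b). *)
have orbit n : exists r : {lrmorphism U -> 'M[k]_2},
  [/\ forall u, r u 1 0 = 0,
    forall l, r (i l) 0 0 = r (i l) 1 1 + c (i l) /\
      r (i l) 1 1 = c (i l) *+ n,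
    ~ (forall l m, GRing.comm (r (i l)) (r (i m))) &
    r (f x) 1 1 = a + n%:R /\ r (f z) 1 1 = b - \sum_(j < n) F (a + j%:R)].
  elim: n => [|n [r [r_tri r_diag r_nC [rx rz]]]].
    exists r0; split=> //.
      by move=> l; rewrite r0_low add0r cE.
    by rewrite big_ord0 subr0 addr0.
  have rtE l : r (t (i l)) = r (i l) + c (i l) *: 1.
    by rewrite tE rmorphD /= linearZ /= rmorph1.
  have [d0 d0E] := diag_char 0 r_tri.
  have rt_tri u : (r \o t) u 1 0 = 0 by exact: r_tri.
  have [d1 d1E] := diag_char 1 rt_tri.
  (* Winding adds [c] to the lower character, which turns it into the former upper one. Agreement on
     L extends to all of U, in particular to the images of x and z. *)
  have d10 : d1 =1 d0.
    apply: (generates_ext i_gen) => l; rewrite d1E d0E /= rtE !mxE mulr1.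
    by have [-> _] := r_diag l.
  have rf_nC : ~ (forall u v, GRing.comm ((r \o f) u) ((r \o f) v)).
    move=> C; apply: r_nC => l m; rewrite -[i l]f'K -[i m]f'K; exact: C.
  have [|ex ez] := A_triangular_diag g_gen g_rel (r := r \o f) _ rf_nC.
    by move=> u; exact: r_tri.
  exists (r \o t); split=> //.
  - move=> l /=; rewrite rtE !mxE /= mulr1; have [-> ->] := r_diag l.
    by rewrite -mulrSr.
  (* Adding scalars to two matrices does not change whether they commute. *)
  - move=> C; apply: r_nC => l m; have := C l m; rewrite /= !rtE.
    exact: comm_shift.
  - have d1d0 u : r (t u) 1 1 = r u 0 0 by rewrite -d0E -d10 d1E.
    rewrite /= !d1d0 ex ez /= rx rz -addrA natr1; split=> //.
    by rewrite big_ord_recr /= opprD addrA.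
(* After p windings the lower character is [p c = 0] on L, the same as at the start. Comparing both
   at z makes the sum of the values of f vanish. *)
have [r [r_tri r_diag _ [_ rz]]] := orbit p.
have {}r_diag l : r (i l) 1 1 = 0.
  by have [_ ->] := r_diag l; rewrite -mulr_natr pcharf0 ?mulr0.
have [d0 d0E] := diag_char 1 r0_tri; have [d dE] := diag_char 1 r_tri.
have dd0 : d =1 d0.
  by apply: (generates_ext i_gen) => l; rewrite dE d0E r_diag r0_low.
move: rz; rewrite -dE dd0 d0E -/b => /eqP.
rewrite -[X in X == _]subr0 (inj_eq (addrI b)) eqr_opp eq_sym.
exact/negP/f_poly_sum_neq0.
Qed.
End RestrictedRepresentations.

(** * Transfer to the presentations of A and u(L) *)

Lemma lrmorphism_inv (k : nzRingType) (A B : algType k)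
    (f : {lrmorphism A -> B}) : bijective f ->
  exists2 f' : {lrmorphism B -> A}, cancel f f' & cancel f' f.
Proof.
case=> h fK hK.
have hz : zmod_morphism h by exact: can2_zmod_morphism fK hK.
have hm : monoid_morphism h by exact: can2_monoid_morphism fK hK.
have hs : scalable h by exact: can2_scalable fK hK.
pose Fz := GRing.isZmodMorphism.Build B A h hz.
pose Fm := GRing.isMonoidMorphism.Build B A h hm.
pose Fs := GRing.isScalable.Build k B A *:%R h hs.
pose FF : {lrmorphism B -> A} := HB.pack h Fz Fm Fs.
by exists FF.
Qed.

Section Presentations.
Context (k : fieldType) (p : nat) (pk : p \in [pchar k]).

Lemma A_alg_relations (g := pgen (A_relator_aug pk)) :
  A_relations p (g (@Ordinal 3 0 isT)) (g (@Ordinal 3 1 isT))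
    (g (@Ordinal 3 2 isT)).
Proof.
have rel := @proj_relator k _ _ (A_relator_aug pk).
have [_ H] := A_relations_morph p (proj (A_relator_aug pk))
  (gen k (@Ordinal 3 0 isT)) (gen k (@Ordinal 3 1 isT)) (gen k (@Ordinal 3 2 isT)).
apply: H; split; last split; apply: rel.
- exact: A_rel_xy.
- exact: A_rel_xz.
- exact: A_rel_yz.
- exact: A_rel_yp.
- exact: A_rel_xp.
- exact: A_rel_zp.
Qed.

Lemma A_alg_lift (B : algType k) (X Y Z : B) : A_relations p X Y Z ->
  exists r : {lrmorphism presented_alg (A_relator_aug pk) -> B},
    [/\ r (pgen _ (@Ordinal 3 0 isT)) = X, r (pgen _ (@Ordinal 3 1 isT)) = Y &
      r (pgen _ (@Ordinal 3 2 isT)) = Z].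
Proof.
move=> rel; pose h (i : 'I_3) := nth 0 [:: X; Y; Z] i.
have [|r rE] := @presented_lift k _ _ (A_relator_aug pk) B h; last first.
  by exists r; split; exact: rE.
have [H _] := A_relations_morph p (free_lift h)
  (gen k (@Ordinal 3 0 isT)) (gen k (@Ordinal 3 1 isT)) (gen k (@Ordinal 3 2 isT)).
have rel' : A_relations p (free_lift h (gen k (@Ordinal 3 0 isT)))
    (free_lift h (gen k (@Ordinal 3 1 isT)))
    (free_lift h (gen k (@Ordinal 3 2 isT))) by rewrite !free_lift_gen.
have [e1 e2 e3 e4 [e5 e6]] := H rel'; move=> r.
(* The relators list the p-th power of x before that of y, whereas [A_relations] puts y first; hence
   the swap. *)
by case; [exact e1|exact e2|exact e3|exact e5|exact e4|exact e6].
Qed.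

Context (L : restrictedLieAlgType k p).

Lemma restricted_env_relations :
  restricted_map (pgen (@u_relator_aug k p pk L)).
Proof.
have rel := @proj_relator k _ _ (@u_relator_aug k p pk L).
have [_ H] := restricted_map_comp (proj (@u_relator_aug k p pk L)) (@gen k L).
apply: H; split=> *; apply: rel.
- exact: u_rel_add.
- exact: u_rel_scale.
- exact: u_rel_bracket.
- exact: u_rel_p_map.
Qed.

(** The universal property of u(L), from which both the counit and the winding endomorphism are
    obtained. *)
Lemma restricted_env_lift (B : algType k) (h : L -> B) : restricted_map h ->
  exists r : {lrmorphism presented_alg (@u_relator_aug k p pk L) -> B},
    forall a, r (pgen _ a) = h a.
Proof.
move=> rel; apply: presented_lift.
have [H _] := restricted_map_comp (free_lift h) (@gen k L).
have rel' : restricted_map (fun a => free_lift h (gen k a)).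
  by rewrite (_ : (fun a => _) = h) //; apply: funext => a; exact: free_lift_gen.
have [e1 e2 e3 e4] := H rel'; move=> r.
by case; [exact e1|exact e2|exact e3|exact e4].
Qed.
End Presentations.

Theorem proposition6p4 (k : closedFieldType) (p : nat) (pk : p \in [pchar k])
    (L : restrictedLieAlgType k p) :
  ~ (exists f : {lrmorphism A_alg pk -> restricted_env pk L}, bijective f).
Proof.
case=> f /lrmorphism_inv[f' fK f'K].
apply: (not_restricted_env pk
  (presented_generates (S_aug := @u_relator_aug k p pk L))
  (restricted_env_relations pk L)
  (@restricted_env_lift k p pk L)
  (presented_generates (S_aug := A_relator_aug pk))
  (A_alg_relations pk)
  (@A_alg_lift k p pk 'M[k]_2) (f := f) f'K fK).
Qed.
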